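(* Let $k$ be a positive integer, $r$ and $n$ positive integers, $\overline{\alpha}_r=(\alpha_0,\dots,\alpha_{r-1})$ complex numbers and $(\overline{\alpha}_r)^n=(\alpha_0^n,\dots,\alpha_{r-1}^n)$. Then for all real $x$ and all $\ell\in\mathbb{N}_0$, $$\prod_{i=1}^{r}\sum_{s_i=0}^{n-1}(\alpha_{i-1})^{s_i}\;M^{[0,r]}_{\ell}\left(x+\frac{\sum_{i=1}^{r}s_i}{n};k;1,e,e;(\overline{\alpha}_r)^n\right)=n^{rk-\ell}M^{[0,r]}_{\ell}(nx;k;1,e,e;\overline{\alpha}_r),$$ and $$\prod_{i=1}^{r}\sum_{s_i=0}^{n-1}(\alpha_{i-1})^{s_i}\;M^{[0,r]}_{r+\ell}\left(x+\frac{\sum_{i=1}^{r}s_i}{n};k;1,e,e;(\overline{\alpha}_r)^n\right)=2^{-r}n^{r(k-1)-\ell}\frac{(\ell+r)!}{\ell!}M^{[0,r]}_{\ell}(nx;k-1;1,e,e;\overline{\alpha}_r).$$ (Here the notation $\prod_i\sum_{s_i}(\alpha_{i-1})^{s_i}M(\dots)$ means the multiple sum over $0\le s_1,\dots,s_r\le n-1$ of $\left(\prod_{i=1}^r\alpha_{i-1}^{s_i}\right)M(\dots)$.)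
   Context: For a nonnegative integer $k$, a positive integer $r$ and complex numbers $\overline{\beta}_r=(\beta_0,\dots,\beta_{r-1})$, the polynomials $M^{[0,r]}_{n}(x;k;1,e,e;\overline{\beta}_{r})$, $n\in\mathbb{N}_0$, are the Taylor coefficients at $t=0$ of $$\frac{t^{rk}2^{r(1-k)}e^{xt}}{\prod_{i=0}^{r-1}\left(\beta_{i}e^{t}-1\right)}=\sum_{n=0}^{\infty}M^{[0,r]}_{n}(x;k;1,e,e;\overline{\beta}_{r})\frac{t^{n}}{n!},$$ the parameters being assumed such that all generating functions involved are analytic in a neighbourhood of $t=0$. *)

(* Defs.v *)
From HB Require Import structures.
From mathcomp Require Import all_boot all_order all_algebra complex.
From mathcomp Require Import all_classical all_reals all_analysis.
Import Order.TTheory GRing.Theory Num.Theory.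
Import numFieldNormedType.Exports.

Set Implicit Arguments.
Unset Strict Implicit.
Unset Printing Implicit Defensive.

Local Open Scope classical_set_scope.
Local Open Scope ring_scope.
Local Open Scope complex_scope.

(* The usual topology of the complex numbers: the analysis library attaches it
   to an abstract [numClosedFieldType], not to the concrete type [R[i]]. *)
HB.instance Definition _ (R : rcfType) :=
  NormedModule.copy R[i] ((R[i] : numClosedFieldType)^o).

Section GeneralizedApostolTypePolynomials.
Variable R : realType.
Local Notation C := R[i].

Definition cexp (z : C) : C :=
  (expR (complex.Re z))%:C *
  (cos (complex.Im z) +i* sin (complex.Im z))%C.

(* The value of [f] at 0 is ignored on purpose: for instance when some beta_i
   equals 1, the generating function below is the quotient 0/0 at 0 (which is 0
   in MathComp), and what is expanded is its continuous extension. *)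
Definition has_taylor0 (f : C -> C) (a : nat -> C) : Prop :=
  \forall t \near (0 : C)^',
    series (fun m => a m * t ^+ m / m`!%:R) @ \oo --> f t.

Definition analytic0 (f : C -> C) : Prop := exists a, has_taylor0 f a.

(* Meaningful only if [analytic0 f] holds (junk value 0 otherwise); the sequence
   is then unique, by uniqueness of power series expansions. *)
Definition taylor0 (f : C -> C) : nat -> C :=
  xget (fun=> 0) [set a | has_taylor0 f a].

Definition genfun (r k : nat) (beta : 'I_r -> C) (x t : C) : C :=
  t ^+ (r * k) * 2 ^ (r%:Z * (1 - k%:Z)) * cexp (x * t)
  / \prod_(i < r) (beta i * cexp t - 1).

Definition genfun_analytic (r k : nat) (beta : 'I_r -> C) : Prop :=
  forall x : C, analytic0 (genfun k beta x).

(* [Mpoly k beta m x] is M^{[0,r]}_m(x; k; 1, e, e; beta). *)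
Definition Mpoly (r k : nat) (beta : 'I_r -> C) (m : nat) (x : C) : C :=
  taylor0 (genfun k beta x) m.

End GeneralizedApostolTypePolynomials.

(* Main.v *)
Require Import Defs.
From mathcomp Require Import all_boot all_order all_algebra complex.
From mathcomp Require Import all_classical all_reals all_analysis.
From mathcomp Require Import ring.
Import Order.TTheory GRing.Theory Num.Theory.
Import numFieldNormedType.Exports.

(* With u = exp(t/n), the factorization
     alpha_i^n e^t - 1 = (alpha_i u - 1) (1 + alpha_i u + ... + (alpha_i u)^(n-1))
   shows that the weighted sum over s of the generating functions for alpha^n at
   x + (sum s)/n equals n^(rk) times the generating function for alpha at nx,
   evaluated at t/n; the first identity compares Taylor coefficients.  It needs
   alpha_i^n e^t <> 1 for all small t <> 0.  The second identity follows from
   the first, since passing from k - 1 to k multiplies the generating function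
   by 2^(-r) t^r. *)

Local Open Scope ring_scope.
Local Open Scope complex_scope.
Local Open Scope classical_set_scope.

(** * Uniqueness of power series coefficients *)

Lemma near_dnbhs0 (K : numFieldType) (P : set K) :
  (\forall t \near (0 : K)^', P t) <->
  exists2 d : K, 0 < d & forall t, t != 0 -> `|t| < d -> P t.
Proof.
split=> [/nbhs_ballP[d /= d0 dP]|[d d0 dP]].
  by exists d => // t t0 td; apply: dP; rewrite //= -ball_normE /= sub0r normrN.
apply/nbhs_ballP; exists d => //= t; rewrite -ball_normE /= sub0r normrN => td t0.
exact: dP.
Qed.

Lemma geometric_tail_le (K : numFieldType) (q : K) (p N : nat) :
  0 <= q -> q *+ 2 <= 1 -> \sum_(p <= m < N) q ^+ m <= q ^+ p *+ 2.
Proof.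
move=> q0 q2; have [Np|pN] := leqP N p.
  by rewrite big_geq // mulrn_wge0 // exprn_ge0.
(* Subtracting twice the next power makes the induction close: the step reduces to [q *+ 2 <= 1]. *)
suff le j : \sum_(p <= m < p + j) q ^+ m <= q ^+ p *+ 2 - q ^+ (p + j) *+ 2.
  rewrite -(subnKC (ltnW pN)); apply: le_trans (le _) _.
  by rewrite gerBl mulrn_wge0 // exprn_ge0.
elim: j => [|j ih]; first by rewrite addn0 subrr big_geq.
rewrite addnS big_nat_recr ?leq_addr //=.
apply: le_trans (lerD ih (lexx _)) _.
rewrite -addrA lerD2l lerNr opprD opprK (mulr2n (q ^+ (p + j))) addrK exprSr -mulrnAr.
by rewrite ler_piMr // exprn_ge0.
Qed.

Lemma cvg0_bounded (K : numFieldType) (u : nat -> K) :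
  u @ \oo --> 0 -> exists2 M : K, 0 < M & forall m, `|u m| <= M.
Proof.
move/cvgr0Pnorm_le => /(_ 1 ltr01)[N _ Nu].
exists (1 + \sum_(m < N) `|u m|) => [|m].
  by rewrite ltr_pwDl // sumr_ge0.
have [mN|Nm] := ltnP m N.
  rewrite (bigD1 (Ordinal mN)) //= addrCA lerDl addr_ge0 // sumr_ge0 //.
apply: le_trans (Nu _ Nm) _; rewrite lerDl sumr_ge0 //.
Qed.

Lemma power_series_eq0 (K : numFieldType) (c : nat -> K) :
  (\forall t \near (0 : K)^', series (fun m => c m * t ^+ m) @ \oo --> (0 : K)) ->
  forall m, c m = 0.
Proof.
(* If [p] is the first index with [c p != 0], the tail of the series at [t0 * q]
   is [O(q ^+ p.+1)], while its term of index [p] has order [q ^+ p]. *)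
move=> /near_dnbhs0[d d0 dc] p; elim/ltn_ind: p => p ih.
pose t0 := d / 2.
have t0_gt0 : 0 < t0 by rewrite divr_gt0.
have t0d : t0 < d by rewrite /t0 ltr_pdivrMr // ltr_pMr // ltr1n.
have ct t : t != 0 -> `|t| <= t0 ->
    series (fun m => c m * t ^+ m) @ \oo --> (0 : K).
  by move=> tn0 tt0; apply: dc => //; exact: le_lt_trans tt0 t0d.
have [M M0 cM] : exists2 M, 0 < M & forall m, `|c m * t0 ^+ m| <= M.
  apply/cvg0_bounded/cvg_series_cvg_0/cvgP/ct; first by rewrite gt_eqF.
  by rewrite gtr0_norm.
have small q : 0 < q -> q *+ 2 <= 1 -> `|c p * t0 ^+ p| <= M * q *+ 3.
  move=> q0 q2; have q1 : q <= 1 by apply: le_trans q2; rewrite mulr2n lerDl ltW.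
  (* The tolerance [M * q ^+ p.+1] has the size of the tail bound, which is twice as large; together
     they give the factor 3. *)
  have /cvgr0Pnorm_le/(_ (M * q ^+ p.+1)) : series (fun m => c m * (t0 * q) ^+ m) @ \oo --> (0 : K).
    apply: ct; first by rewrite mulf_neq0 // gt_eqF.
    by rewrite normrM !gtr0_norm // ler_piMr // ltW.
  rewrite mulr_gt0 ?exprn_gt0 // => /(_ isT)[N _ /(_ (p.+1 + N)%N) /=].
  rewrite leq_addl /series /= => /(_ isT).
  rewrite (big_cat_nat (n := p.+1)) ?leq_addr //= big_nat_recr //= big1_seq ?add0r; last first.
    by move=> j; rewrite mem_index_iota => /andP[_ /andP[_ jp]]; rewrite ih // mul0r.
  set T := \sum_(_ <= _ < _) _ => le1.
  have leT : `|T| <= M * q ^+ p.+1 *+ 2.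
    apply: le_trans (ler_norm_sum _ _ _) _.
    apply: (@le_trans _ _ (\sum_(p.+1 <= m < p.+1 + N) M * q ^+ m)).
      apply: ler_sum => m _; rewrite exprMn mulrA normrM (ger0_norm (exprn_ge0 _ (ltW q0))).
      by rewrite ler_wpM2r // exprn_ge0 // ltW.
    by rewrite -mulr_sumr -mulrnAr (ler_wpM2l (ltW M0)) // geometric_tail_le // ltW.
  have : `|c p * (t0 * q) ^+ p| <= M * q ^+ p.+1 *+ 3.
    rewrite -[X in `|X|](addrK T) mulrS.
    by apply: le_trans (ler_normB _ _) _; exact: lerD.
  rewrite exprMn mulrA normrM (gtr0_norm (exprn_gt0 _ q0)) exprS mulrA -mulrnAl.
  by rewrite ler_pM2r // exprn_gt0.
apply/eqP; apply: contraT => cp0.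
have A0 : 0 < `|c p * t0 ^+ p|.
  by rewrite normr_gt0 mulf_neq0 // expf_neq0 // gt_eqF.
(* With [A] the norm of the term of index [p] at [t0], the choice [q = A / (6 M)] turns the bound
   into [A <= A / 2]; it satisfies [q *+ 2 <= 1] because [A <= M]. *)
have := small (`|c p * t0 ^+ p| / (M * 6%:R)).
set A := `|_| in A0 * => {}small.
have M6 : 0 < M * 6%:R by rewrite mulr_gt0.
have Aq : M * (A / (M * 6%:R)) *+ 3 = A / 2.
  by field; rewrite gt_eqF.
have : A <= A / 2.
  rewrite -Aq; apply: small; first by rewrite divr_gt0.
  rewrite -[leLHS]mulr_natr mulrAC ler_pdivrMr // mul1r.
  by apply: ler_pM; rewrite ?(ltW A0) ?ler_nat //; exact: cM.
by rewrite ler_pdivlMr // ger_pMr // lern1.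
Qed.

(** * Operations on Taylor expansions at 0 *)

Section TaylorExpansions.
Variable K : numFieldType.
Implicit Types (f g : K -> K) (a b : nat -> K) (c : K).

(* For [K := R[i]] this is convertible to [has_taylor0], which is how the lemmas
   below are applied. *)
Definition expands0 f a : Prop :=
  \forall t \near (0 : K)^', series (fun m => a m * t ^+ m / m`!%:R) @ \oo --> f t.

Lemma eq_expands0 f g a :
  (\forall t \near (0 : K)^', f t = g t) -> expands0 f a -> expands0 g a.
Proof. by move=> fg; apply: filterS2 fg => t ->. Qed.

Lemma expands0D f g a b : expands0 f a -> expands0 g b ->
  expands0 (fun t => f t + g t) (fun m => a m + b m).
Proof.
apply: filterS2 => t fa gb.
rewrite [X in X @ _](_ : _ = series (fun m => a m * t ^+ m / m`!%:R)
  + series (fun m => b m * t ^+ m / m`!%:R)); first exact: cvgD.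
apply/funext => N; rewrite /series /= fctE -big_split /=.
by apply: eq_bigr => m _; rewrite !mulrDl.
Qed.

Lemma expands0Z c f a : expands0 f a ->
  expands0 (fun t => c * f t) (fun m => c * a m).
Proof.
apply: filterS => t fa.
rewrite [X in X @ _](_ : _ =
  fun N => c * series (fun m => a m * t ^+ m / m`!%:R) N); first exact: cvgMl_tmp.
apply/funext => N; rewrite /series /= mulr_sumr.
by apply: eq_bigr => m _; rewrite !mulrA.
Qed.

Lemma expands0_sum (I : Type) (s : seq I) (F : I -> K -> K)
    (A : I -> nat -> K) :
  (forall i, expands0 (F i) (A i)) ->
  expands0 (fun t => \sum_(i <- s) F i t) (fun m => \sum_(i <- s) A i m).
Proof.
move=> FA; elim: s => [|i s ih].
  under eq_fun do rewrite big_nil; under [X in expands0 _ X]eq_fun do rewrite big_nil.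
  apply: nearW => t; rewrite [X in X @ _](_ : _ = cst 0); first exact: cvg_cst.
  by apply/funext => N; rewrite /series /= big1 // => m _; rewrite !mul0r.
under eq_fun do rewrite big_cons; under [X in expands0 _ X]eq_fun do rewrite big_cons.
exact: expands0D.
Qed.

Lemma expands0_dilation c f a : c != 0 -> expands0 f a ->
  expands0 (fun t => f (c * t)) (fun m => c ^+ m * a m).
Proof.
move=> c0 /near_dnbhs0[d d0 fa]; apply/near_dnbhs0.
exists (d / `|c|) => [|t t0 td]; first by rewrite divr_gt0 ?normr_gt0.
rewrite [X in X @ _](_ : _ = series (fun m => a m * (c * t) ^+ m / m`!%:R)).
  by apply: fa; rewrite ?mulf_neq0 // normrM mulrC -ltr_pdivlMr // normr_gt0.
by apply/funext => N; apply: eq_bigr => m _; rewrite exprMn; congr (_ / _); ring.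
Qed.

(** With coefficients normalised by [m!], the shift by [r] produces the quotient [m! / (m - r)!],
    the source of [(l + r)! / l!] in the second identity. *)
Lemma expands0_mulXn r f a : expands0 f a ->
  expands0 (fun t => t ^+ r * f t)
    (fun m => if (m < r)%N then 0 else m`!%:R / (m - r)`!%:R * a (m - r)%N).
Proof.
(* The new partial sum of length [N + r] is [t ^+ r] times the old one of length [N]. *)
apply: filterS => t fa; rewrite -(cvg_shiftn r).
rewrite [X in X @ _](_ : _ =
  fun N => t ^+ r * series (fun m => a m * t ^+ m / m`!%:R) N); first exact: cvgMl_tmp.
apply/funext => N; rewrite /series /= addnC (big_cat_nat (n := r)) ?leq_addr //=.
rewrite big1_seq ?add0r; last first.
  by move=> j; rewrite mem_index_iota => /andP[_ /andP[_ ->]]; rewrite !mul0r.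
rewrite -[X in \sum_(X <= _ < _) _]add0n big_addn addKn mulr_sumr.
apply: eq_bigr => m _; rewrite ltnNge leq_addl /= addnK exprD.
have fac0 j : j`!%:R != 0 :> K by rewrite pnatr_eq0 -lt0n fact_gt0.
by field; rewrite !fac0.
Qed.

Lemma expands0_inj f a b : expands0 f a -> expands0 f b -> a = b.
Proof.
move=> fa fb; apply/funext => m.
have fac0 j : j`!%:R != 0 :> K by rewrite pnatr_eq0 -lt0n fact_gt0.
suff /(_ m)/eqP : forall m, (a m - b m) / m`!%:R = 0.
  by rewrite mulf_eq0 invr_eq0 (negPf (fac0 m)) orbF subr_eq0 => /eqP.
have h := expands0D _ _ _ _ fa (expands0Z (-1) _ _ fb).
apply: power_series_eq0.
apply: filterS h => t; rewrite mulN1r subrr.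
rewrite [X in X @ _ --> _ -> _](_ : _ = series (fun m => (a m - b m) / m`!%:R * t ^+ m)) //.
by apply/funext => N; apply: eq_bigr => j _; rewrite mulN1r mulrAC.
Qed.

End TaylorExpansions.

Lemma has_taylor0_taylor0 (R : realType) (f : R[i] -> R[i]) :
  analytic0 f -> has_taylor0 f (taylor0 f).
Proof. exact: xgetPex. Qed.

(** Since [taylor0] is a choice among expansions, uniqueness is what lets an explicit expansion
    compute it. *)
Lemma taylor0E (R : realType) (f : R[i] -> R[i]) a :
  has_taylor0 f a -> taylor0 f = a.
Proof.
move=> fa; apply: (@expands0_inj R[i] f _ _ _ fa).
by apply: has_taylor0_taylor0; exists a.
Qed.

(** * The complex exponential near 0 *)

Section ComplexExponential.
Variable R : realType.
Implicit Types z w : R[i].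

Lemma cexpD z w : cexp (z + w) = cexp z * cexp w.
Proof.
case: z w => [a b] [c d]; rewrite /cexp /= expRD cosD sinD rmorphM /=.
by apply/eqP; rewrite eq_complex /=; apply/andP; split; apply/eqP; ring.
Qed.

Lemma cexp0 : cexp 0 = 1 :> R[i].
Proof. by rewrite /cexp /= expR0 cos0 sin0 mul1r. Qed.

Lemma cexp_sum (I : Type) (s : seq I) (F : I -> R[i]) :
  cexp (\sum_(i <- s) F i) = \prod_(i <- s) cexp (F i).
Proof. by apply: (big_morph (@cexp R) cexpD cexp0). Qed.

Lemma cexpMn z n : cexp (n%:R * z) = cexp z ^+ n.
Proof.
elim: n => [|n ih]; first by rewrite mul0r cexp0.
by rewrite -nat1r mulrDl mul1r cexpD ih exprS.
Qed.

(** For [z = a + ib], the imaginary part gives [sin b = 0], so [b = 0] since [|b| < 1 < pi]; then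
    [exp a = 1] gives [a = 0]. *)
Lemma cexp_eq1 z : `|z| < 1 -> cexp z = 1 -> z = 0.
Proof.
case: z => a b; rewrite normc_def /= => z1 /eqP.
rewrite /cexp eq_complex /= !mul0r subr0 addr0 => /andP[/eqP e1 /eqP e2].
have s0 : sin b = 0.
  by move/eqP: e2; rewrite mulf_eq0 expR_eq0 /= => /eqP.
have ab1 : a ^+ 2 + b ^+ 2 < 1.
  have : Num.sqrt (a ^+ 2 + b ^+ 2) < 1 by move: z1; rewrite ltcR.
  by rewrite -[X in _ < X]sqrtr1 ltr_sqrt.
have b1 : `|b| < 1.
  rewrite -(@expr_lt1 _ 2) // real_normK ?num_real //.
  by apply: le_lt_trans ab1; rewrite lerDr sqr_ge0.
have sin_neq0 (y : R) : 0 < y -> y < 1 -> sin y != 0.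
  move=> y0 y1; rewrite gt_eqF //; apply: sin_gt0_pi; rewrite y0 /=.
  by apply: lt_trans y1 _; apply: lt_le_trans (pi_ge2 R); rewrite ltr1n.
have b0 : b = 0.
  move: b1; rewrite ltr_norml => /andP[bN1 b1].
  have [b_lt0|b_gt0|//] := ltrgt0P b.
    by have := sin_neq0 _ b_lt0 b1; rewrite s0 eqxx.
  have := sin_neq0 (- b); rewrite oppr_gt0 sinN s0 oppr0 eqxx => /(_ b_gt0).
  by rewrite ltrNl => /(_ bN1).
move: e1; rewrite b0 cos0 mulr1 -expR0 => /expR_inj ->.
by [].
Qed.

Lemma near_mul_cexp_neq1 (b : R[i]) :
  \forall t \near (0 : R[i])^', b * cexp t != 1.
Proof.
(* Two solutions in a disc of radius 1/2 differ by a period of [cexp] of modulus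
   less than 1, so they coincide. *)
apply: (near_dnbhs0 R[i] _).2.
have [[t1 [t10 t1h] bt1]|no] :=
    pselect (exists2 t, t != 0 /\ `|t| < 2^-1 & b * cexp t = 1).
  (* A solution [t] strictly closer to 0 than [t1] would have to equal [t1], so the radius [|t1|]
     works. *)
  exists `|t1| => [|t t0 tt1]; first by rewrite normr_gt0.
  apply/eqP => bt.
  have b0 : b != 0 by apply: contra_eq_neq bt1 => ->; rewrite mul0r eq_sym oner_eq0.
  have e1 : cexp t1 != 0.
    by apply: contra_eq_neq bt1 => ->; rewrite mulr0 eq_sym oner_eq0.
  have ee : cexp t = cexp t1 by apply: (mulfI b0); rewrite bt bt1.
  have /eqP : t - t1 = 0.
    apply: cexp_eq1.
      apply: le_lt_trans (ler_normB _ _) _.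
      by rewrite [ltRHS](splitr 1) mul1r ltrD // (lt_trans tt1).
    by apply: (mulIf e1); rewrite -cexpD subrK mul1r.
  by rewrite subr_eq0 => /eqP tE; rewrite tE ltxx in tt1.
exists 2^-1 => [|t t0 th]; first by rewrite invr_gt0.
by apply/eqP => bt; apply: no; exists t.
Qed.

End ComplexExponential.

(** * The multiplication formula and the passage from [k - 1] to [k] *)

Section MultiplicationFormula.
Variables (R : realType) (r : nat) (alpha : 'I_r -> R[i]).

Lemma genfun_sum (n k : nat) (x t : R[i]) : (0 < n)%N ->
  (forall i, alpha i ^+ n * cexp t != 1) ->
  \sum_(s : {ffun 'I_r -> 'I_n}) (\prod_(i < r) alpha i ^+ s i) *
    genfun k (fun i => alpha i ^+ n) (x + (\sum_(i < r) (s i)%:R) / n%:R) t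
  = n%:R ^+ (r * k) * genfun k alpha (n%:R * x) (n%:R^-1 * t).
Proof.
move=> n0 at1; have nn0 : n%:R != 0 :> R[i] by rewrite pnatr_eq0 -lt0n.
pose u := cexp (n%:R^-1 * t).
have ut : cexp t = u ^+ n by rewrite -cexpMn mulVKf.
have factor i : alpha i ^+ n * cexp t - 1 =
    (alpha i * u - 1) * \sum_(j < n) (alpha i * u) ^+ j.
  by rewrite ut -exprMn subrX1.
have sum_neq0 : \prod_(i < r) \sum_(j < n) (alpha i * u) ^+ j != 0.
  apply/prodf_neq0 => i _; move: (at1 i); rewrite -subr_eq0 factor mulf_eq0.
  by rewrite negb_or => /andP[].
rewrite /genfun (eq_bigr _ (fun i _ => factor i)) big_split /=.
set P := 2 ^ _; set D := \prod_(i < r) (alpha i * u - 1).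
set S := \prod_(i < r) \sum_(j < n) _ in sum_neq0 *.
(* The right-hand side is extended by [S / S], which is legitimate as [S] is nonzero; [n ^ (rk)]
   cancels against [(t / n) ^ (rk)]. *)
transitivity (t ^+ (r * k) * P * cexp (x * t) / (D * S) * S); last first.
  rewrite (_ : n%:R * x * (n%:R^-1 * t) = x * t); last by field.
  by rewrite invfM (mulrA _ D^-1) mulfVK // exprMn exprVn !mulrA mulfV ?mul1r ?expf_neq0.
(* Expanding the product [S] gives one term per choice [s] of exponents, and the powers of [u] add
   up to the exponential that shifts [x] by [(sum s) / n]. *)
rewrite {3}/S bigA_distr_bigA mulr_sumr; apply: eq_bigr => s _.
under [X in _ = _ * X]eq_bigr do rewrite exprMn.
rewrite big_split /=.
have -> : \prod_(i < r) u ^+ s i = cexp ((\sum_(i < r) (s i)%:R) / n%:R * t).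
  by rewrite -mulrA mulr_suml cexp_sum; apply: eq_bigr => i _; rewrite cexpMn.
by rewrite mulrDl cexpD; ring.
Qed.

(** Dilation by [1 / n] contributes [n ^ (-l)] to the coefficient of index [l]; as [r * k - l] may
    be negative, the exponent is an integer. *)
Lemma Mpoly_mul (n k : nat) (x : R[i]) (l : nat) : (0 < n)%N ->
  genfun_analytic k (fun i => alpha i ^+ n) -> genfun_analytic k alpha ->
  \sum_(s : {ffun 'I_r -> 'I_n}) (\prod_(i < r) alpha i ^+ s i) *
    Mpoly k (fun i => alpha i ^+ n) l (x + (\sum_(i < r) (s i)%:R) / n%:R)
  = n%:R ^ ((r * k)%:Z - l%:Z) * Mpoly k alpha l (n%:R * x).
Proof.
move=> n0 anpow an; have nn0 : n%:R != 0 :> R[i] by rewrite pnatr_eq0 -lt0n.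
have lhs := expands0_sum R[i] _ (index_enum _) _ _
  (fun s : {ffun 'I_r -> 'I_n} => expands0Z R[i] (\prod_(i < r) alpha i ^+ s i) _ _
    (has_taylor0_taylor0 _ _ (anpow (x + (\sum_(i < r) (s i)%:R) / n%:R)))).
have nV0 : n%:R^-1 != 0 :> R[i] by rewrite invr_eq0.
have rhs := expands0Z R[i] (n%:R ^+ (r * k)) _ _ (expands0_dilation R[i] _ _ _ nV0
  (has_taylor0_taylor0 _ _ (an (n%:R * x)))).
have eq_lhs_rhs : \forall t \near (0 : R[i])^',
    \sum_(s : {ffun 'I_r -> 'I_n}) (\prod_(i < r) alpha i ^+ s i) *
      genfun k (fun i => alpha i ^+ n) (x + (\sum_(i < r) (s i)%:R) / n%:R) t
    = n%:R ^+ (r * k) * genfun k alpha (n%:R * x) (n%:R^-1 * t).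
  have at1 : \forall t \near (0 : R[i])^', forall i, alpha i ^+ n * cexp t != 1.
    by apply: filter_forall => i; exact: near_mul_cexp_neq1.
  by apply: filterS at1 => t; exact: genfun_sum.
have coefE := expands0_inj R[i] _ _ _ (eq_expands0 R[i] _ _ _ eq_lhs_rhs lhs) rhs.
apply: etrans (congr1 (fun a => a l) coefE) _.
by rewrite mulrA exprVn exprnN expfzDr.
Qed.

(** The exponent of [t] grows by [r] and that of 2 drops by [r]; [0 < k] makes the truncated [k - 1]
    a true predecessor. *)
Lemma genfun_pred (k : nat) (x t : R[i]) : (0 < k)%N ->
  genfun k alpha x t = 2 ^- r * (t ^+ r * genfun (k - 1) alpha x t).
Proof.
case: k => // k _; rewrite subn1 /= /genfun mulnS exprD.
have -> : (r%:Z * (1 - k.+1%:Z) = r%:Z * (1 - k%:Z) - r%:Z)%R by rewrite -addn1 PoszD; ring.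
by rewrite expfzDr ?pnatr_eq0 // exprnN; ring.
Qed.

Lemma has_taylor0_genfun_pred (k : nat) (x : R[i]) : (0 < k)%N ->
  genfun_analytic (k - 1) alpha ->
  has_taylor0 (genfun k alpha x) (fun m => 2 ^- r *
    (if (m < r)%N then 0
     else m`!%:R / (m - r)`!%:R * Mpoly (k - 1) alpha (m - r) x)).
Proof.
move=> k0 an; rewrite (_ : genfun k alpha x = fun t =>
  2 ^- r * (t ^+ r * genfun (k - 1) alpha x t)); last first.
  by apply/funext => t; exact: genfun_pred.
exact (expands0Z R[i] _ _ _ (expands0_mulXn R[i] r _ _ (has_taylor0_taylor0 _ _ (an x)))).
Qed.

End MultiplicationFormula.

Theorem theorem3p5 (R : realType) (k r n : nat)
    (hk : (0 < k)%N) (hr : (0 < r)%N) (hn : (0 < n)%N)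
    (alpha : 'I_r -> R[i])
    (hpow : genfun_analytic k (fun i => alpha i ^+ n)) :
  (genfun_analytic k alpha ->
   forall (x : R) (l : nat),
     \sum_(s : {ffun 'I_r -> 'I_n})
        (\prod_(i < r) alpha i ^+ s i) *
        Mpoly k (fun i => alpha i ^+ n) l
          (x + (\sum_(i < r) (s i)%:R) / n%:R)%:C
     = n%:R ^ ((r * k)%:Z - l%:Z) * Mpoly k alpha l (n%:R * x)%:C)
  /\
  (genfun_analytic (k - 1) alpha ->
   forall (x : R) (l : nat),
     \sum_(s : {ffun 'I_r -> 'I_n})
        (\prod_(i < r) alpha i ^+ s i) *
        Mpoly k (fun i => alpha i ^+ n) (r + l)
          (x + (\sum_(i < r) (s i)%:R) / n%:R)%:C
     = 2 ^- r * n%:R ^ ((r * (k - 1))%:Z - l%:Z)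
       * ((l + r)`!%:R / l`!%:R) * Mpoly (k - 1) alpha l (n%:R * x)%:C).
Proof.
have xE (x : R) (s : {ffun 'I_r -> 'I_n}) :
    (x + (\sum_(i < r) (s i)%:R) / n%:R)%:C
    = x%:C + (\sum_(i < r) (s i)%:R) / n%:R :> R[i].
  rewrite rmorphD rmorphM fmorphV rmorph_nat rmorph_sum /=.
  by congr (_ + _ / _); apply: eq_bigr => i _; rewrite rmorph_nat.
have nxE (x : R) : (n%:R * x)%:C = n%:R * x%:C :> R[i].
  by rewrite rmorphM rmorph_nat.
split=> an x l; under eq_bigr do rewrite xE; rewrite nxE.
  exact: Mpoly_mul.
(* The explicit expansion obtained from [k - 1] witnesses analyticity for [k]. *)
have ank : genfun_analytic k alpha.
  by move=> y; eexists; exact: has_taylor0_genfun_pred.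
rewrite Mpoly_mul // {1}/Mpoly (taylor0E _ _ _ (has_taylor0_genfun_pred _ _ _ _ _ hk an)).
(* The index [r + l] is at least [r], so the shifted coefficient is the one of index [l]. *)
rewrite ltnNge leq_addr /= addKn addnC.
have -> : ((r * k)%:Z - (l + r)%:Z = (r * (k - 1))%:Z - l%:Z)%R.
  by case: (k) hk => // j _; rewrite subn1 /= mulnS !PoszD; ring.
by ring.
Qed.
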